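(* Let $V$ be a complex Hilbert space with $\dim V=\infty$, let $\Omega=\{z\in\mathbb C:|z|<1\}$ and $z_0\in\Omega\setminus\{0\}$. Then there is a $T\in\mathrm{End}^+V$ such that $$\sup\{\|P(z_0)\|: P\in C^2_{\mathrm{op}}(\Omega,\mathrm{End}^+V),\ P\ge\mathrm{Id},\ R^P=0,\ P(0)=T\}=\infty.$$ $T$ can be chosen a multiple of $\mathrm{Id}$.
   Context: $\mathrm{End}\,V$ is the space of continuous linear operators on $V$ with operator norm $\|\cdot\|$; $\mathrm{End}^+V$ is the cone of positive (self-adjoint) invertible operators; $C^2_{\mathrm{op}}$ means twice continuously differentiable for the operator norm; $P\ge\mathrm{Id}$ means $P(z)\ge\mathrm{Id}$ in the operator order for all $z\in\Omega$. The curvature of $P$ is $R^P=\overline\partial(P^{-1}\partial P)=P^{-1}(P_{\overline z}P^{-1}P_z-P_{z\overline z})\,dz\wedge d\overline z$, where subscripts denote partial derivatives. *)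

(* Defs.v *)
From HB Require Import structures.
From mathcomp Require Import all_boot all_order all_algebra.
From mathcomp Require Import sesquilinear complex.
From mathcomp Require Import all_classical all_reals all_analysis.

Set Implicit Arguments.
Unset Strict Implicit.
Unset Printing Implicit Defensive.

Import Order.TTheory GRing.Theory Num.Theory.
Import numFieldNormedType.Exports.

Local Open Scope classical_set_scope.
Local Open Scope complex_scope.
Local Open Scope ring_scope.

HB.instance Definition _ (R : realType) := NormedModule.copy R[i] R[i]^o.

Section endo_type.
Context {R : realType} {V : normedModType R[i]}.

Definition cont_linear : {pred V -> V} :=
  mem [set f : V -> V | linear f /\ continuous f].

Lemma cont_linearP (f : V -> V) :
  f \in cont_linear <-> linear f /\ continuous f.
Proof. by split=> [/set_mem|/mem_set]. Qed.

Lemma cont_linear_submod_closed : submod_closed cont_linear.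
Proof.
split.
  apply/cont_linearP; split; last exact: cst_continuous.
  by move=> a x y; rewrite /= scaler0 addr0.
move=> a f g /cont_linearP[lf cf] /cont_linearP[lg cg].
apply/cont_linearP; split => [b x y|x].
  rewrite /= !fctE lf lg scalerDr scalerDr !scalerA (mulrC a b).
  by rewrite addrACA.
exact: (cvgD (cvgZr (cf x)) (cg x)).
Qed.

HB.instance Definition _ :=
  GRing.isSubmodClosed.Build R[i] (V -> V) cont_linear
    cont_linear_submod_closed.

Record endo := Endo {
  endo_fun :> V -> V;
  endo_funP : endo_fun \in cont_linear }.

HB.instance Definition _ := [isSub for endo_fun].
HB.instance Definition _ := [Choice of endo by <:].
HB.instance Definition _ := [SubChoice_isSubLmodule of endo by <:].

Implicit Types (A B C : endo) (x y : V).

Lemma endoP A B : A =1 B -> A = B.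
Proof. by move=> AB; apply/val_inj/funext. Qed.

Lemma endo_linear A : linear A.
Proof. by case/cont_linearP: (endo_funP A). Qed.

Lemma endo_continuous A : continuous A.
Proof. by case/cont_linearP: (endo_funP A). Qed.

HB.instance Definition _ A :=
  GRing.isLinear.Build R[i] V V *:%R A (endo_linear A).

Fact id_cont_linear : (id : V -> V) \in cont_linear.
Proof. by apply/cont_linearP; split=> [//|x]; exact: cvg_id. Qed.

Fact comp_cont_linear A B : A \o B \in cont_linear.
Proof.
apply/cont_linearP; split=> [a x y|x]; first by rewrite /= !linearP.
by apply: continuous_comp; exact: endo_continuous.
Qed.

Definition id_endo := Endo id_cont_linear.
Definition comp_endo A B := Endo (comp_cont_linear A B).

Fact comp_endoA : associative comp_endo.
Proof. by move=> A B C; exact: endoP. Qed.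
Fact comp_1endo : left_id id_endo comp_endo.
Proof. by move=> A; exact: endoP. Qed.
Fact comp_endo1 : right_id id_endo comp_endo.
Proof. by move=> A; exact: endoP. Qed.
Fact comp_endoDl : left_distributive comp_endo +%R.
Proof. by move=> A B C; exact: endoP. Qed.
Fact comp_endoDr : right_distributive comp_endo +%R.
Proof. by move=> A B C; apply: endoP => x; exact: linearD. Qed.

HB.instance Definition _ := GRing.Zmodule_isPzRing.Build endo
  comp_endoA comp_1endo comp_endo1 comp_endoDl comp_endoDr.

Definition opnorm A : R := sup [set complex.Re `|A x| | x in [set x | `|x| <= 1]].

Lemma ReK x : (complex.Re `|x|)%:C = `|x|.
Proof. by rewrite RRe_real// normr_real. Qed.

Lemma Re_norm_le x y : (`|x| <= `|y|) = (complex.Re `|x| <= complex.Re `|y|).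
Proof. by rewrite -lecR !ReK. Qed.

Lemma endo_bounded A :
  exists2 M : R, 0 <= M & forall x, complex.Re `|A x| <= M * complex.Re `|x|.
Proof.
have /linear_bounded_continuous/linear_boundedP := @endo_continuous A.
move=> /pinfty_ex_gt0[r r0 Ar].
have rE : (complex.Re r)%:C = r by rewrite RRe_real// gtr0_real.
exists (complex.Re r); first by rewrite -lecR rE ltW.
by move=> x; rewrite -lecR rmorphM /= rE !ReK; exact: Ar.
Qed.

Lemma opnorm_has_sup A :
  has_sup [set complex.Re `|A x| | x in [set x | `|x| <= 1]].
Proof.
split; first by exists (complex.Re `|A 0|); exists 0 => //=; rewrite normr0.
have [M M0 AM] := endo_bounded A; exists M => _ [x /= x1 <-].
apply: (le_trans (AM x)); rewrite ler_piMr//.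
by rewrite -lecR ReK.
Qed.

Lemma opnorm_ge0 A : 0 <= opnorm A.
Proof.
apply: (ub_le_sup (opnorm_has_sup A).2).
by exists 0; rewrite /= ?normr0// linear0 normr0.
Qed.

Lemma opnorm_ub A x : complex.Re `|A x| <= opnorm A * complex.Re `|x|.
Proof.
have [->|x0] := eqVneq x 0; first by rewrite linear0 normr0 /= mulr0.
have n0 : 0 < complex.Re `|x| by rewrite -ltcR ReK normr_gt0.
rewrite -ler_pdivrMr// mulrC.
have <- : complex.Re `|A ((complex.Re `|x|)^-1%:C *: x)| = (complex.Re `|x|)^-1 * complex.Re `|A x|.
  apply: (@complexI R); rewrite ReK linearZ normrZ rmorphM /= ReK.
  by rewrite ger0_norm// lecR invr_ge0 ltW.
apply: (ub_le_sup (opnorm_has_sup A).2); eexists; last reflexivity.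
rewrite /= normrZ ger0_norm ?lecR ?invr_ge0 ?(ltW n0)//.
by rewrite -ReK -rmorphM /= mulVf ?gt_eqF.
Qed.

Lemma opnorm_le A (M : R) :
  (forall x, `|x| <= 1 -> complex.Re `|A x| <= M) -> opnorm A <= M.
Proof.
move=> AM; apply: ge_sup; first exact: (opnorm_has_sup A).1.
by move=> _ [x /= x1 <-]; exact: AM.
Qed.

Fact opnormD A B : (opnorm (A + B))%:C <= (opnorm A)%:C + (opnorm B)%:C.
Proof.
rewrite -rmorphD /= lecR; apply: opnorm_le => x x1.
have x1' : complex.Re `|x| <= 1 by rewrite -lecR ReK.
have leM C : complex.Re `|C x| <= opnorm C.
  by apply: (le_trans (opnorm_ub C x)); rewrite ler_piMr// opnorm_ge0.
apply: (@le_trans _ _ (complex.Re `|A x| + complex.Re `|B x|)).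
  by rewrite -lecR rmorphD /= !ReK; exact: ler_normD.
exact: lerD.
Qed.

Fact opnormZ (a : R[i]) A : (opnorm (a *: A))%:C = `|a| * (opnorm A)%:C.
Proof.
have aE : (complex.Re `|a|)%:C = `|a| by rewrite RRe_real// normr_real.
have le b C : opnorm (b *: C) <= complex.Re `|b| * opnorm C.
  apply: opnorm_le => x x1.
  have bE : (complex.Re `|b|)%:C = `|b| by rewrite RRe_real// normr_real.
  have -> : complex.Re `|(b *: C) x| = complex.Re `|b| * complex.Re `|C x|.
    by apply: (@complexI R); rewrite rmorphM /= !ReK bE -normrZ.
  apply: ler_wpM2l; first by rewrite -lecR bE; exact: normr_ge0.
  apply: (le_trans (opnorm_ub C x)); rewrite ler_piMr// ?opnorm_ge0//.
  by rewrite -lecR ReK.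
suff -> : opnorm (a *: A) = complex.Re `|a| * opnorm A.
  by rewrite -{2}aE; exact: (rmorphM (real_complex R)).
apply/eqP; rewrite eq_le le andTb.
have [->|a0] := eqVneq a 0; first by rewrite normr0 /= mul0r opnorm_ge0.
have n0 : 0 < complex.Re `|a| by rewrite -ltcR aE normr_gt0.
rewrite mulrC -ler_pdivlMr// mulrC.
have -> : (complex.Re `|a|)^-1 = complex.Re `|a^-1|.
  suff -> : `|a^-1| = ((complex.Re `|a|)^-1)%:C by [].
  by rewrite normfV -[in LHS]aE; symmetry; exact: (fmorphV (real_complex R)).
by have := le a^-1 (a *: A); rewrite scalerA mulVf// scale1r.
Qed.

Fact opnorm0_eq0 A : (opnorm A)%:C = 0 -> A = 0.
Proof.
move=> A0c; have A0 : opnorm A = 0 by exact: (@complexI R).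
apply: endoP => x; apply/eqP.
rewrite -normr_eq0 -ReK; suff -> : complex.Re `|A x| = 0 by [].
apply/eqP; rewrite eq_le; apply/andP; split; last by rewrite -lecR ReK; exact: normr_ge0.
by apply: (le_trans (opnorm_ub A x)); rewrite A0 mul0r.
Qed.

HB.instance Definition _ := Lmodule_isNormed.Build R[i] endo
  opnormD opnormZ opnorm0_eq0.

End endo_type.

Arguments endo {R} V.

Section calculus.
Context {R : realType} {W : normedModType R[i]}.
Implicit Types (f : R[i] -> W) (z v : R[i]) (D : set R[i]).

(* The library's [derive] for maps between normed modules over [R[i]] lets the
   increment range over [R[i]], i.e. it is the complex derivative. Partial
   derivatives need its analogue with a real increment [t]. *)
Definition rquotient f z v : R -> W :=
  fun t => (t%:C)^-1 *: (f (z + t%:C * v) - f z).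

Definition rderivable f z v : Prop := cvg (rquotient f z v t @[t --> 0^']).

Definition rderive v f : R[i] -> W :=
  fun z => lim (rquotient f z v t @[t --> 0^']).

Definition dz f : R[i] -> W :=
  fun z => 2^-1 *: (rderive 1 f z - 'i%C *: rderive 'i%C f z).

Definition dzbar f : R[i] -> W :=
  fun z => 2^-1 *: (rderive 1 f z + 'i%C *: rderive 'i%C f z).

(* The directions [1] and ['i] are those of the coordinates of [z = x + 'i y].
   [D] is meant to be open, so that continuity at the points of [D] does not
   depend on the values of [f] outside [D]. *)
Fixpoint continuously_differentiable (k : nat) D f : Prop :=
  (forall z, D z -> {for z, continuous f}) /\
  (if k is k'.+1 then
     forall v, v \in [:: 1; 'i%C] ->
       (forall z, D z -> rderivable f z v) /\
       continuously_differentiable k' D (rderive v f)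
   else True).

End calculus.

Definition unit_disc (R : realType) : set R[i] := [set z | `|z| < 1].

Definition finite_dimensional (R : realType) (V : lmodType R[i]) : Prop :=
  exists (n : nat) (e : 'I_n -> V), forall x : V,
    exists c : 'I_n -> R[i], x = \sum_(i < n) c i *: e i.

Section operators.
Context {R : realType} {V : normedModType R[i]}.
Implicit Types (A B : endo V) (P : R[i] -> endo V).

Definition is_inverse A B : Prop := A * B = 1 /\ B * A = 1.

Definition endo_inv A : endo V := xget 0 [set B | is_inverse A B].

Variable dot : {dot V for Num.conj}.

Definition inner_product_norm : Prop := forall x : V, `|x| ^+ 2 = dot x x.

Definition self_adjoint A : Prop := forall x y, dot (A x) y = dot x (A y).

Definition op_le A B : Prop := forall x, dot (A x) x <= dot (B x) x.

Definition End_plus : set (endo V) :=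
  [set A | [/\ self_adjoint A, op_le 0 A & exists B, is_inverse A B]].

(* Coefficient of dz /\ dzbar in the curvature of P. *)
Definition curvature P : R[i] -> endo V := fun z =>
  endo_inv (P z) *
    (dzbar P z * endo_inv (P z) * dz P z - dzbar (dz P) z).

(* Only the values of P on the unit disc are constrained. *)
Definition flat_metrics (T : endo V) : set (R[i] -> endo V) :=
  [set P | [/\ continuously_differentiable 2 (@unit_disc R) P,
               forall z, unit_disc z -> End_plus (P z),
               forall z, unit_disc z -> op_le 1 (P z),
               forall z, unit_disc z -> curvature P z = 0 &
               P 0 = T]].

End operators.

(* Main.v *)
(**
  If [F] is operator-valued, holomorphic and invertible, then [F^* F] is flat, and
  it is [>= Id] as soon as [F^-1] is a contraction.  Take [F^-1 = c^-1 (1 - z A)]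
  with [A = |z0|^-1 S], where [S] is the shift along [n] orthonormal vectors
  [e_0, .., e_(n-1)], and [c = 1 + |z0|^-1].  Then [F^-1] is contractive on the
  disc, [F 0 = c Id] does not depend on [n], and since [S] is nilpotent [F] is the
  polynomial [c (1 + z A + z^2 A^2 + ..)].  At [z0] all the vectors
  [z0^k A^k e_0] with [k < n] have norm 1 and are orthogonal, so that [|F(z0) e_0|^2 = c^2 n],
  which is unbounded in [n].
*)

Require Import Defs.
From HB Require Import structures.
From mathcomp Require Import all_boot all_order all_algebra.
From mathcomp Require Import sesquilinear complex.
From mathcomp Require Import all_classical all_reals all_analysis.

Set Implicit Arguments.
Unset Strict Implicit.
Unset Printing Implicit Defensive.

Import Order.TTheory GRing.Theory Num.Theory.
Import numFieldNormedType.Exports.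

Local Open Scope classical_set_scope.
Local Open Scope complex_scope.
Local Open Scope ring_scope.

(** * Wirtinger derivatives, and polynomials in [z] and its conjugate *)

Section wirtinger.
Context {R : realType}.
Implicit Types (z v : R[i]).

(* Both partial derivatives at once: the derivative of [f] along [v] is
   [v f_z + v^* f_zbar]. *)
Definition has_wirtinger (W : normedModType R[i]) (f fz fzbar : R[i] -> W) :=
  forall v z, rquotient f z v t @[t --> 0^'] --> v *: fz z + Num.conj v *: fzbar z.

Lemma real_complex_cvg0 : (t%:C : R[i]) @[t --> (0 : R)^'] --> (0 : R[i]).
Proof.
apply/cvgr0Pnorm_lt => e e0.
have eE : (complex.Re e)%:C = e by rewrite RRe_real// gtr0_real.
have e0' : 0 < complex.Re e by rewrite -ltcR eE.
near=> t.
have -> : `|t%:C : R[i]| = `|t|%:C by rewrite normc_def /= expr0n addr0 sqrtr_sqr.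
rewrite -eE ltcR.
near: t; exact: dnbhs0_lt.
Unshelve. all: by end_near. Qed.

Lemma line_cvg z v : z + t%:C * v @[t --> (0 : R)^'] --> z.
Proof.
rewrite -[X in _ --> X]addr0 -[X in _ --> _ + X](mul0r v).
apply: cvgD; first exact: cvg_cst.
apply: cvgM; [exact: real_complex_cvg0|exact: cvg_cst].
Qed.

Lemma real_complex_dnbhs0_neq0 : \forall t \near (0 : R)^', (t%:C : R[i]) != 0.
Proof.
near=> t; rewrite eq_complex /= eqxx andbT; near: t; exact: nbhs_dnbhs_neq.
Unshelve. all: by end_near. Qed.

Section rules.
Context {W : normedModType R[i]}.
Implicit Types (f g h fz fzbar : R[i] -> W) (s sz szbar : R[i] -> R[i]) (w : W).

Lemma has_wirtinger_cst w : has_wirtinger (cst w) (cst 0) (cst 0).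
Proof.
move=> v z; rewrite /cst /= !scaler0 addr0.
have -> : rquotient (cst w) z v = cst 0.
  by apply/funext => t; rewrite /rquotient /cst subrr scaler0.
exact: cvg_cst.
Qed.

Lemma has_wirtingerD f fz fzbar g gz gzbar :
  has_wirtinger f fz fzbar -> has_wirtinger g gz gzbar ->
  has_wirtinger (f \+ g) (fz \+ gz) (fzbar \+ gzbar).
Proof.
move=> df dg v z /=.
have -> : rquotient (f \+ g) z v = rquotient f z v \+ rquotient g z v.
  by apply/funext => t; rewrite /rquotient /= -scalerDr opprD addrACA.
by rewrite !scalerDr addrACA; apply: cvgD.
Qed.

Lemma has_wirtingerZ s sz szbar f fz fzbar :
  continuous f ->
  has_wirtinger s sz szbar -> has_wirtinger f fz fzbar ->
  has_wirtinger (fun z => s z *: f z) (fun z => sz z *: f z + s z *: fz z)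
    (fun z => szbar z *: f z + s z *: fzbar z).
Proof.
move=> cf ds df v z.
(* Leibniz splitting with [f] taken at the displaced point: the limit of that factor is where
   continuity of [f] enters. *)
have -> : rquotient (fun z => s z *: f z) z v =
  (fun t => rquotient s z v t *: f (z + t%:C * v) + s z *: rquotient f z v t).
  apply/funext => t; rewrite /rquotient -[_ *: (s _ - s _)]/(_ * (s _ - s _)).
  rewrite -[X in _ = X + _]scalerA [X in _ = _ + X]scalerA [s z * _]mulrC.
  rewrite -[X in _ = _ + X]scalerA -scalerDr; congr (_ *: _).
  by rewrite scalerBl scalerBr addrA subrK.
have -> : v *: (sz z *: f z + s z *: fz z) +
    Num.conj v *: (szbar z *: f z + s z *: fzbar z) =
  (v *: sz z + Num.conj v *: szbar z) *: f z + s z *: (v *: fz z + Num.conj v *: fzbar z).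
  rewrite scalerDl !scalerDr !scalerA addrACA; congr (_ + _).
  by rewrite ![s z * _]mulrC.
apply: cvgD; last by apply: cvgZ; [exact: cvg_cst|exact: df].
apply: cvgZ; first exact: ds.
by apply: continuous_cvg; [exact: cf|exact: line_cvg].
Qed.

Lemma has_wirtinger_rderivable f fz fzbar z v :
  has_wirtinger f fz fzbar -> rderivable f z v.
Proof. by move=> df; apply: cvgP; exact: df. Qed.

Lemma has_wirtinger_rderive f fz fzbar v :
  has_wirtinger f fz fzbar ->
  rderive v f = (fun z => v *: fz z + Num.conj v *: fzbar z).
Proof.
by move=> df; apply/funext => z; apply: cvg_lim; [exact: norm_hausdorff|exact: df].
Qed.

(** Along [1] and ['i] the derivatives are [fz + fzbar] and ['i (fz - fzbar)]; the combination in
    [dz] cancels [fzbar]. *)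
Lemma has_wirtinger_dz f fz fzbar : has_wirtinger f fz fzbar -> dz f = fz.
Proof.
move=> df; apply/funext => z.
rewrite /dz !(has_wirtinger_rderive _ df) /= conjC1 !scale1r ['i%C *: (_ + _)]scalerDr !scalerA.
have -> : Num.conj 'i%C = - 'i%C :> R[i] by apply/eqP; rewrite eq_complex /= oppr0 !eqxx.
rewrite mulrN -expr2 sqr_i opprK scaleN1r scale1r opprD opprK addrACA subrr addr0.
by rewrite -[X in _ *: (X + X)]scale1r -scalerDl scalerA -[1 + 1]/2%:R mulVf ?pnatr_eq0// scale1r.
Qed.

Lemma has_wirtinger_dzbar f fz fzbar : has_wirtinger f fz fzbar -> dzbar f = fzbar.
Proof.
move=> df; apply/funext => z.
rewrite /dzbar !(has_wirtinger_rderive _ df) /= conjC1 !scale1r ['i%C *: (_ + _)]scalerDr !scalerA.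
have -> : Num.conj 'i%C = - 'i%C :> R[i] by apply/eqP; rewrite eq_complex /= oppr0 !eqxx.
rewrite mulrN -expr2 sqr_i opprK scaleN1r scale1r addrACA subrr add0r.
by rewrite -[X in _ *: (X + X)]scale1r -scalerDl scalerA -[1 + 1]/2%:R mulVf ?pnatr_eq0// scale1r.
Qed.

End rules.

Lemma has_wirtinger_id : has_wirtinger (id : R[i] -> R[i]) (cst 1) (cst 0).
Proof.
move=> v z; rewrite /cst /= scaler0 addr0 [_ *: _]mulr1.
apply: cvg_near_cst; near=> t.
rewrite /rquotient addrAC subrr add0r [_ *: _]mulrA mulVf ?mul1r//.
near: t; exact: real_complex_dnbhs0_neq0.
Unshelve. all: by end_near. Qed.

Lemma has_wirtinger_conj : has_wirtinger (Num.conj : R[i] -> R[i]) (cst 0) (cst 1).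
Proof.
move=> v z; rewrite /cst /= scaler0 add0r [_ *: _]mulr1.
apply: cvg_near_cst; near=> t.
rewrite /rquotient rmorphD rmorphM /= addrAC subrr add0r.
have -> : Num.conj t%:C = t%:C :> R[i] by apply/eqP; rewrite eq_complex /= oppr0 !eqxx.
rewrite [_ *: _]mulrA mulVf ?mul1r//.
near: t; exact: real_complex_dnbhs0_neq0.
Unshelve. all: by end_near. Qed.

Lemma conj_continuous : continuous (Num.conj : R[i] -> R[i]).
Proof.
move=> z A /nbhs_ballP[e e0 eA]; apply/nbhs_ballP; exists e => // y zy.
apply: eA; move: zy; rewrite -ball_normE /= => zy.
by rewrite -rmorphB norm_conjC.
Qed.

(** Polynomials in [z] and its conjugate with coefficients in [W]. The class is stable under both
    Wirtinger derivatives, so differentiability of every order follows by induction. *)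
Inductive zpoly (W : normedModType R[i]) : (R[i] -> W) -> Prop :=
| zpoly_cst w : zpoly (cst w)
| zpolyD f g : zpoly f -> zpoly g -> zpoly (f \+ g)
| zpolyX f : zpoly f -> zpoly (fun z => z *: f z)
| zpolyXbar f : zpoly f -> zpoly (fun z => Num.conj z *: f z).

Section zpoly_theory.
Context {W : normedModType R[i]}.
Implicit Types (f : R[i] -> W).

Lemma zpoly_continuous f : zpoly f -> continuous f.
Proof.
elim=> {f} [w|f g _ cf _ cg|f _ cf|f _ cf] z; first exact: cst_continuous.
- by apply: (@continuousD _ _ _ f g z); [exact: cf|exact: cg].
- by apply: (@continuousZ _ _ _ id f z); [exact: cvg_id|exact: cf].
- by apply: (@continuousZ _ _ _ Num.conj f z); [exact: conj_continuous|exact: cf].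
Qed.

Lemma zpoly_scale f (a : R[i]) : zpoly f -> zpoly (fun z => a *: f z).
Proof.
elim=> {f} [w|f g _ cf _ cg|f _ cf|f _ cf]; first exact: (zpoly_cst (a *: w)).
- suff -> : (fun z => a *: (f \+ g) z) = (fun z => a *: f z) \+ (fun z => a *: g z).
    exact: zpolyD.
  by apply/funext => z; rewrite /= scalerDr.
- suff -> : (fun z => a *: (z *: f z)) = (fun z => z *: (a *: f z)).
    exact: zpolyX.
  by apply/funext => z; rewrite !scalerA mulrC.
- suff -> : (fun z => a *: (Num.conj z *: f z)) = (fun z => Num.conj z *: (a *: f z)).
    exact: zpolyXbar.
  by apply/funext => z; rewrite !scalerA mulrC.
Qed.

Lemma zpoly_wirtinger f : zpoly f ->
  exists fz fzbar, [/\ zpoly fz, zpoly fzbar & has_wirtinger f fz fzbar].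
Proof.
elim=> {f} [w|f g _ [fz [fb [pz pb df]]] _ [gz [gb [qz qb dg]]]
  |f pf [fz [fb [pz pb df]]]|f pf [fz [fb [pz pb df]]]].
- exists (cst 0), (cst 0); split; [exact: zpoly_cst|exact: zpoly_cst|].
  exact: has_wirtinger_cst.
- exists (fz \+ gz), (fb \+ gb); split; [exact: zpolyD|exact: zpolyD|].
  exact: has_wirtingerD.
- exists (f \+ (fun z => z *: fz z)), (fun z => z *: fb z).
  split; [by apply: zpolyD => //; exact: zpolyX|exact: zpolyX|].
  have := has_wirtingerZ (zpoly_continuous pf) has_wirtinger_id df.
  congr has_wirtinger; apply/funext => z; first by rewrite /= scale1r.
  by rewrite /= scale0r add0r.
- exists (fun z => Num.conj z *: fz z), (f \+ (fun z => Num.conj z *: fb z)).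
  split; [exact: zpolyXbar|by apply: zpolyD => //; exact: zpolyXbar|].
  have := has_wirtingerZ (zpoly_continuous pf) has_wirtinger_conj df.
  congr has_wirtinger; apply/funext => z; last by rewrite /= scale1r.
  by rewrite /= scale0r add0r.
Qed.

Lemma zpoly_continuously_differentiable k (D : set R[i]) f :
  zpoly f -> continuously_differentiable k D f.
Proof.
elim: k f => [|k IHk] f pf; split=> //; try by move=> z _; exact: zpoly_continuous.
have [fz [fb [pz pb df]]] := zpoly_wirtinger pf.
move=> v _; split; first by move=> z _; exact: has_wirtinger_rderivable df.
rewrite (has_wirtinger_rderive v df); apply: IHk.
by apply: (@zpolyD _ (fun z => v *: fz z)); exact: zpoly_scale.
Qed.

End zpoly_theory.
End wirtinger.

(** * Products and inverses of operator-valued functions, and vanishing of the curvature *)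

Section operator_product.
Context {R : realType} {V : normedModType R[i]}.
Implicit Types (A B : endo V) (F G : R[i] -> endo V) (a : R[i]).

Lemma opnormM A B : `|A * B| <= `|A| * `|B|.
Proof.
rewrite -[`|A * B|]/((opnorm (A * B))%:C) -[`|A|]/((opnorm A)%:C).
rewrite -[`|B|]/((opnorm B)%:C) -rmorphM /= lecR; apply: opnorm_le => x x1.
have x1' : complex.Re `|x| <= 1 by rewrite -lecR ReK.
apply: (le_trans (opnorm_ub A (B x))); apply: ler_wpM2l; first exact: opnorm_ge0.
by apply: (le_trans (opnorm_ub B x)); rewrite ler_piMr// opnorm_ge0.
Qed.

Lemma endo_scalerAl a A B : a *: A * B = a *: (A * B).
Proof. exact: endoP. Qed.

Lemma endo_scalerAr a A B : A * (a *: B) = a *: (A * B).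
Proof. by apply: endoP => x; exact: linearZ. Qed.

Lemma cvg_endoM (T : Type) (FF : set_system T) (f g : T -> endo V) A B :
  Filter FF -> f @ FF --> A -> g @ FF --> B -> (f \* g) @ FF --> A * B.
Proof.
move=> FFF fA gB; apply/cvgrPdist_lt => e e0.
(* The two error terms will be at most [d (|B| + 1)] and [|A| d], which add up to [e]; the [1] comes
   from bounding [|g t|] by [|B| + 1]. *)
pose d := e / (`|A| + `|B| + 1).
have s0 : 0 < `|A| + `|B| + 1 by rewrite ltr_wpDl// addr_ge0.
have d0 : 0 < d by rewrite divr_gt0.
move/cvgrPdist_lt: (gB) => /(_ _ ltr01) gB1.
move/cvgrPdist_lt: fA => /(_ d d0) fAd; move/cvgrPdist_lt: gB => /(_ d d0) gBd.
near=> t.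
have fd : `|A - f t| < d by near: t.
have gd : `|B - g t| < d by near: t.
have g1 : `|B - g t| < 1 by near: t.
have -> : A * B - (f \* g) t = (A - f t) * g t + A * (B - g t).
  by rewrite /= mulrBl mulrBr [RHS]addrC subrKA.
apply: (le_lt_trans (ler_normD _ _)).
have gt : `|g t| <= `|B| + 1.
  rewrite -[g t](subrK B) addrC (le_trans (ler_normD _ _))// lerD2l distrC.
  exact: ltW.
have -> : e = d * (`|B| + 1) + `|A| * d.
  by rewrite [`|A| * d]mulrC -mulrDr [X in d * X]addrC addrA divfK// gt_eqF.
apply: ltr_leD.
  apply: (le_lt_trans (opnormM _ _)).
  apply: (@le_lt_trans _ _ (`|A - f t| * (`|B| + 1))); first exact: ler_wpM2l.
  by rewrite ltr_pM2r// ltr_wpDl.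
by apply: (le_trans (opnormM _ _)); apply: ler_wpM2l => //; exact: ltW.
Unshelve. all: by end_near. Qed.

Lemma has_wirtingerM F Fz Fzbar G Gz Gzbar :
  continuous G ->
  has_wirtinger F Fz Fzbar -> has_wirtinger G Gz Gzbar ->
  has_wirtinger (F \* G) (Fz \* G \+ F \* Gz) (Fzbar \* G \+ F \* Gzbar).
Proof.
move=> cG dF dG v z.
have -> : rquotient (F \* G) z v =
  (rquotient F z v \* (fun t => G (z + t%:C * v))) \+ (cst (F z) \* rquotient G z v).
  apply/funext => t; rewrite /rquotient /= endo_scalerAl endo_scalerAr -scalerDr.
  by rewrite mulrBl mulrBr addrA subrK.
have -> : v *: (Fz \* G \+ F \* Gz) z + Num.conj v *: (Fzbar \* G \+ F \* Gzbar) z =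
  (v *: Fz z + Num.conj v *: Fzbar z) * G z + F z * (v *: Gz z + Num.conj v *: Gzbar z).
  by rewrite /= !scalerDr mulrDl mulrDr !endo_scalerAl !endo_scalerAr addrACA.
apply: cvgD; apply: cvg_endoM; [exact: dF| |exact: cvg_cst|exact: dG].
by apply: continuous_cvg; [exact: cG|exact: line_cvg].
Qed.

(** Scalars commute with operators, so [z] and its conjugate can be pulled out of either factor
    while the operator coefficients keep their order. *)
Lemma zpolyM F G : zpoly F -> zpoly G -> zpoly (F \* G).
Proof.
move=> pF pG; elim: pF => {F} [A|F F' _ pF _ pF'|F _ pF|F _ pF].
- elim: pG => {G} [B|G G' _ pG _ pG'|G _ pG|G _ pG].
  + exact: (zpoly_cst (A * B)).
  + have := zpolyD pG pG'; congr zpoly; apply/funext => z /=; exact/esym/mulrDr.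
  + have := zpolyX pG; congr zpoly; apply/funext => z /=; exact/esym/endo_scalerAr.
  + have := zpolyXbar pG; congr zpoly; apply/funext => z /=; exact/esym/endo_scalerAr.
- have := zpolyD pF pF'; congr zpoly; apply/funext => z /=; exact/esym/mulrDl.
- have := zpolyX pF; congr zpoly; apply/funext => z /=; exact/esym/endo_scalerAl.
- have := zpolyXbar pF; congr zpoly; apply/funext => z /=; exact/esym/endo_scalerAl.
Qed.

(** Two-sided inverses are unique, and the witness [B] rules out the default value [0] of [xget]. *)
Lemma endo_invE A B : is_inverse A B -> endo_inv A = B.
Proof.
move=> [AB BA]; rewrite /endo_inv; case: xgetP => [C _ [AC CA]|/(_ B)]; last by case.
by rewrite -[C]mulr1 -AB mulrA CA mul1r.
Qed.

Lemma is_inverseM A A' B B' :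
  is_inverse A A' -> is_inverse B B' -> is_inverse (A * B) (B' * A').
Proof.
move=> [AA' A'A] [BB' B'B]; split; rewrite mulrA.
  by rewrite -(mulrA A) BB' mulr1.
by rewrite -(mulrA B') A'A mulr1.
Qed.

(** For [P = G F] with [F] holomorphic and [G] antiholomorphic, [P_z = G F'], [P_zbar = G' F] and
    the mixed derivative is [G' F']. It equals [P_zbar P^-1 P_z = G' F F^-1 G^-1 G F']. *)
Lemma curvature_eq0 F F' F'' F1 G G' G1 :
  continuous F -> continuous F' ->
  has_wirtinger F F' (cst 0) -> has_wirtinger F' F'' (cst 0) ->
  has_wirtinger G (cst 0) G' ->
  (forall z, is_inverse (F z) (F1 z)) -> (forall z, is_inverse (G z) (G1 z)) ->
  curvature (G \* F) = cst 0.
Proof.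
move=> cF cF' dF dF' dG FF1 GG1; apply/funext => z.
have dGF := has_wirtingerM cF dG dF.
rewrite /curvature (endo_invE (is_inverseM (GG1 z) (FF1 z))).
have dzGF : dz (G \* F) = G \* F'.
  by rewrite (has_wirtinger_dz dGF); apply/funext => y; rewrite /= mul0r add0r.
rewrite dzGF (has_wirtinger_dzbar dGF) (has_wirtinger_dzbar (has_wirtingerM cF' dG dF')).
rewrite /= !mulr0 !addr0 !mulrA -(mulrA (G' z)) (FF1 z).1 mulr1.
by rewrite -(mulrA (G' z)) (GG1 z).2 mulr1 subrr mulr0.
Qed.

End operator_product.

(** * Inverses of affine pencils as finite geometric sums *)

Section resolvent.
Context {R : realType} {V : normedModType R[i]}.
Implicit Types (A B : endo V) (F L : R[i] -> endo V).

(** The resolvent identity [F w - F z = F w (L w - L z) (- F z)] reduces the difference quotient of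
    [F] to that of [L]. Holomorphy of [F] is thus inherited from the pencil, without differentiating
    the geometric sum. *)
Lemma has_wirtinger_inverse L Lz Lzbar F :
  (forall z, is_inverse (L z) (F z)) -> continuous F ->
  has_wirtinger L Lz Lzbar ->
  has_wirtinger F (fun z => - (F z * Lz z * F z)) (fun z => - (F z * Lzbar z * F z)).
Proof.
move=> LF cF dL v z.
have -> : rquotient F z v =
    (fun t => F (z + t%:C * v)) \* rquotient L z v \* cst (- F z).
  apply/funext => t; rewrite /rquotient /= endo_scalerAr endo_scalerAl; congr (_ *: _).
  rewrite mulrN mulrBr mulrBl (LF _).2 mul1r -(mulrA (F _)) (LF _).1 mulr1.
  by rewrite opprB.
have -> : v *: - (F z * Lz z * F z) + Num.conj v *: - (F z * Lzbar z * F z) =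
    F z * (v *: Lz z + Num.conj v *: Lzbar z) * - F z.
  by rewrite mulrDr mulrDl !endo_scalerAr !endo_scalerAl !mulrN.
apply: cvg_endoM; last exact: cvg_cst.
apply: cvg_endoM; last exact: dL.
by apply: continuous_cvg; [exact: cF|exact: line_cvg].
Qed.

Definition geometric A m (z : R[i]) : endo V := \sum_(k < m) (z *: A) ^+ k.

Lemma exprZ_endo (z : R[i]) A k : (z *: A) ^+ k = z ^+ k *: A ^+ k.
Proof.
elim: k => [|k IHk]; first by rewrite !expr0 scale1r.
by rewrite !exprS IHk endo_scalerAl endo_scalerAr scalerA.
Qed.

Lemma zpoly_sum (W : normedModType R[i]) m (f : nat -> R[i] -> W) :
  (forall k, zpoly (f k)) -> zpoly (fun z => \sum_(k < m) f k z).
Proof.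
move=> pf; elim: m => [|m IHm].
  by have := zpoly_cst (0 : W); congr zpoly; apply/funext => z; rewrite big_ord0.
by have := zpolyD IHm (pf m); congr zpoly; apply/funext => z; rewrite big_ord_recr.
Qed.

Lemma zpoly_geometric A m : zpoly (geometric A m).
Proof.
apply: (@zpoly_sum _ _ (fun k z => (z *: A) ^+ k)) => k.
elim: k => [|k IHk]; first exact: (zpoly_cst (1 : endo V)).
have := zpolyX (zpolyM (zpoly_cst A) IHk); congr zpoly; apply/funext => z /=.
by rewrite exprS endo_scalerAl.
Qed.

Lemma zpoly_geometric_conj A m : zpoly (geometric A m \o Num.conj).
Proof.
apply: (@zpoly_sum _ _ (fun k z => (Num.conj z *: A) ^+ k)) => k.
elim: k => [|k IHk]; first exact: (zpoly_cst (1 : endo V)).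
have := zpolyXbar (zpolyM (zpoly_cst A) IHk); congr zpoly; apply/funext => z /=.
by rewrite exprS endo_scalerAl.
Qed.

(** The product telescopes on one side; the other side follows since both factors are polynomials in
    [A] and commute. *)
Lemma geometric_inverse A m z :
  A ^+ m = 0 -> is_inverse (1 - z *: A) (geometric A m z).
Proof.
move=> A0.
have inv : (1 - z *: A) * geometric A m z = 1.
  by rewrite -opprB mulNr -subrX1 exprZ_endo A0 scaler0 sub0r opprK.
split=> //; rewrite -[RHS]inv; apply/commr_sym/commr_sum => k _; apply: commrX.
by apply: commr_sym; apply: commrB; [exact: commr1|exact: commr_refl].
Qed.

Lemma is_inverse_sym A B : is_inverse A B -> is_inverse B A.
Proof. by case. Qed.

Lemma is_inverseZ (c : R[i]) A B : c != 0 ->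
  is_inverse A B -> is_inverse (c^-1 *: A) (c *: B).
Proof.
move=> c0 [AB BA]; split; rewrite endo_scalerAl endo_scalerAr scalerA.
  by rewrite mulVf// AB scale1r.
by rewrite mulfV// BA scale1r.
Qed.

Lemma has_wirtinger_pencil A (c : R[i]) :
  has_wirtinger (fun z => c *: (1 - z *: A)) (cst (- (c *: A))) (cst 0).
Proof.
have cA : continuous (cst (- (c *: A)) : R[i] -> endo V) by exact: cst_continuous.
have := has_wirtingerD (has_wirtinger_cst (c *: (1 : endo V)))
  (has_wirtingerZ cA has_wirtinger_id (has_wirtinger_cst _)).
congr has_wirtinger; apply/funext => z /=.
- by rewrite scalerBr scalerN !scalerA mulrC.
- by rewrite scaler0 addr0 add0r scale1r.
- by rewrite scaler0 addr0 add0r scale0r.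
Qed.

Lemma has_wirtinger_pencil_conj A (c : R[i]) :
  has_wirtinger (fun z => c *: (1 - Num.conj z *: A)) (cst 0) (cst (- (c *: A))).
Proof.
have cA : continuous (cst (- (c *: A)) : R[i] -> endo V) by exact: cst_continuous.
have := has_wirtingerD (has_wirtinger_cst (c *: (1 : endo V)))
  (has_wirtingerZ cA has_wirtinger_conj (has_wirtinger_cst _)).
congr has_wirtinger; apply/funext => z /=.
- by rewrite scalerBr scalerN !scalerA mulrC.
- by rewrite scaler0 addr0 add0r scale0r.
- by rewrite scaler0 addr0 add0r scale1r.
Qed.

End resolvent.

(** * The flat metric built from a nilpotent operator and its adjoint *)

Section nilpotent_metric.
Context {R : realType} {V : normedModType R[i]} (dot : {dot V for Num.conj}).
Implicit Types (A B : endo V).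

(** A relation between two given operators: an adjoint is exhibited explicitly for the shift, then
    carried through powers and inverses. *)
Definition adjoint A B := forall x y, dot (A x) y = dot x (B y).

Lemma dotC x y : dot x y = Num.conj (dot y x).
Proof. by rewrite hermC expr0 mul1r. Qed.

Lemma adjoint_sym A B : adjoint A B -> adjoint B A.
Proof. by move=> AB x y; rewrite dotC -AB -dotC. Qed.

Lemma adjoint_exp A B k : adjoint A B -> adjoint (A ^+ k) (B ^+ k).
Proof.
move=> AB; elim: k => [//|k IHk] x y.
by rewrite exprS exprSr /= AB IHk.
Qed.

(** [<B^m x, B^m x> = <A^m B^m x, x> = 0]. *)
Lemma adjoint_nilpotent A B m : adjoint A B -> A ^+ m = 0 -> B ^+ m = 0.
Proof.
move=> AB A0; apply: endoP => x; apply/eqP; rewrite -(dnorm_eq0 dot).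
by rewrite -(adjoint_exp m AB) A0 linear0l.
Qed.

(** Writing [y = B (B' y)] and moving [B] across as [A] cancels [A']. *)
Lemma adjoint_inverse A B A' B' : adjoint A B ->
  is_inverse A A' -> is_inverse B B' -> adjoint A' B'.
Proof.
move=> AB [AA' _] [BB' _] x y.
have xE : A (A' x) = x by rewrite -[LHS]/((A * A') x) AA'.
have yE : B (B' y) = y by rewrite -[LHS]/((B * B') y) BB'.
by rewrite -{1}yE -AB xE.
Qed.

(* When [B] is the adjoint of [A] and [A ^+ m = 0], this is [F^* F] for
   [F z = c (1 - z A)^-1]. *)
Definition nilpotent_metric A B m (c : R[i]) : R[i] -> endo V :=
  (fun z => c *: geometric B m (Num.conj z)) \* (fun z => c *: geometric A m z).

Section flat.
Variables (A B : endo V) (m : nat) (c : R[i]).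
Hypothesis dotE : inner_product_norm dot.
Hypothesis c0 : 0 < c.
Hypothesis AB : adjoint A B.
Hypothesis A0 : A ^+ m = 0.
(** Pointwise form of [1 + |A| <= c]; it makes [L z] below a contraction on the disc. *)
Hypothesis Ac : forall x, `|x| + `|A x| <= c * `|x|.

(** [F] is holomorphic, [G] is its pointwise adjoint and hence antiholomorphic; [L] and [M] are
    their respective inverses. *)
Let F z := c *: geometric A m z.
Let G z := c *: geometric B m (Num.conj z).
Let L z := c^-1 *: (1 - z *: A).
Let M z := c^-1 *: (1 - Num.conj z *: B).

Let LF z : is_inverse (L z) (F z).
Proof. by apply: is_inverseZ; [rewrite gt_eqF|exact: geometric_inverse]. Qed.

Let MG z : is_inverse (M z) (G z).
Proof.
apply: is_inverseZ; first by rewrite gt_eqF.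
by apply: geometric_inverse; exact: adjoint_nilpotent A0.
Qed.

Let FG z : adjoint (F z) (G z).
Proof.
apply: adjoint_inverse (LF z) (MG z) => x y; rewrite /L /M.
have cr : Num.conj c^-1 = c^-1 by apply/CrealP; rewrite realV gtr0_real.
rewrite -![(_ *: _ : endo V) _]/(_ *: (_ - _ *: _ _)).
rewrite [LHS]linearZl_LR [RHS]linearZr_LR /= cr; congr (_ * _).
by rewrite linearBl linearBr /= linearZl_LR linearZr_LR /= conjCK AB.
Qed.

Lemma nilpotent_metric_dot z x : dot (nilpotent_metric A B m c z x) x =
  dot ((c *: geometric A m z) x) ((c *: geometric A m z) x).
Proof. exact: (adjoint_sym (FG z)). Qed.

(** Since [x = L z (F z x)] and [L z] is a contraction, [|x| <= |F z x|]. *)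
Let dot_F_ge z x : unit_disc z -> dot x x <= dot (F z x) (F z x).
Proof.
move=> z1; rewrite -!dotE lerXn2r ?nnegrE//.
have {1}-> : x = L z (F z x) by rewrite -[RHS]/((L z * F z) x) (LF z).1.
set y := F z x; rewrite -[L z y]/(c^-1 *: (y - z *: A y)) normrZ ger0_norm ?invr_ge0 ?(ltW c0)//.
rewrite ler_pdivrMl//; apply: le_trans (Ac y).
apply: (le_trans (ler_normB _ _)); rewrite lerD2l normrZ ler_piMl//; exact: ltW.
Qed.

Lemma nilpotent_metric_flat :
  flat_metrics dot (c ^+ 2 *: (1 : endo V)) (nilpotent_metric A B m c).
Proof.
have zF : zpoly F by apply: zpoly_scale; exact: zpoly_geometric.
have zG : zpoly G by apply: zpoly_scale; exact: zpoly_geometric_conj.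
split.
- by apply: zpoly_continuously_differentiable; exact: zpolyM.
- move=> z z1; split.
  + by move=> x y; rewrite -[LHS]/(dot (G z (F z x)) y) (adjoint_sym (FG z)) (FG z).
  + by move=> x; rewrite nilpotent_metric_dot linear0l dnorm_ge0.
  + exists (L z * M z); exact: is_inverseM (is_inverse_sym (MG z)) (is_inverse_sym (LF z)).
- by move=> z z1 x; rewrite nilpotent_metric_dot; exact: dot_F_ge.
- move=> z z1.
  have cF : continuous F by exact: zpoly_continuous.
  (* [F' = - F L' F] with [L' = - c^-1 A]. In this product form [F'] is again a polynomial, and the
     product rule shows that it is holomorphic. *)
  have dF : has_wirtinger F ((F \* cst (c^-1 *: A)) \* F) (cst 0).
    have := has_wirtinger_inverse LF cF (@has_wirtinger_pencil _ _ A c^-1).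
    congr has_wirtinger; apply/funext => y /=; first by rewrite mulrN mulNr opprK.
    by rewrite mulr0 mul0r oppr0.
  have [G' dG] : exists G', has_wirtinger G (cst 0) G'.
    eexists; have := has_wirtinger_inverse MG (zpoly_continuous zG)
      (@has_wirtinger_pencil_conj _ _ B c^-1).
    by congr has_wirtinger; apply/funext => y /=; rewrite mulr0 mul0r oppr0.
  have zFA : zpoly (F \* cst (c^-1 *: A)) by apply: zpolyM => //; exact: zpoly_cst.
  have [F'' dF'] : exists F'', has_wirtinger ((F \* cst (c^-1 *: A)) \* F) F'' (cst 0).
    eexists; have := has_wirtingerM cF
      (has_wirtingerM (@cst_continuous _ _ _) dF (has_wirtinger_cst (c^-1 *: A))) dF.
    by congr has_wirtinger; apply/funext => y /=; rewrite !mulr0 !mul0r !addr0 mul0r.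
  have cF' : continuous ((F \* cst (c^-1 *: A)) \* F).
    by apply: zpoly_continuous; exact: zpolyM.
  by rewrite (curvature_eq0 cF cF' dF dF' dG (fun y => is_inverse_sym (LF y))
    (fun y => is_inverse_sym (MG y))).
(* At [z = 0] both pencils reduce to [c^-1], so both factors of the metric are [c]. *)
- have X0 (X : endo V) Y : is_inverse (c^-1 *: (1 - 0 *: X)) Y -> Y = c *: (1 : endo V).
    rewrite scale0r subr0 => -[]; rewrite endo_scalerAl mul1r => <- _.
    by rewrite scalerA mulfV ?scale1r// gt_eqF.
  have -> : nilpotent_metric A B m c 0 = G 0 * F 0 by [].
  have := MG 0; rewrite /M conjC0 => /X0 ->.
  by rewrite (X0 _ _ (LF 0)) endo_scalerAl endo_scalerAr mulr1 scalerA.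
Qed.

End flat.
End nilpotent_metric.

(** * Bessel's inequality, transfer operators and orthonormal families *)

Section orthonormal.
Context {R : realType} {V : normedModType R[i]} (dot : {dot V for Num.conj}).
Implicit Types (e f : nat -> V) (x y : V).

(* Zero vectors are allowed, so that a finite orthonormal family can be extended
   by [0] to a sequence that the shift maps into itself. *)
Definition suborthonormal e :=
  (forall i j, i != j -> dot (e i) (e j) = 0) /\ (forall i, dot (e i) (e i) <= 1).

Lemma dot_sum_suborthonormal e n (c : nat -> R[i]) : suborthonormal e ->
  dot (\sum_(i < n) c i *: e i) (\sum_(i < n) c i *: e i) =
  \sum_(i < n) `|c i| ^+ 2 * dot (e i) (e i).
Proof.
move=> [eo _]; rewrite linear_sumlz; apply: eq_bigr => i _.
rewrite linear_sumr /= (bigD1 i)//= big1 ?addr0; last first.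
  by move=> j ji; rewrite linearZl_LR linearZr_LR /= eo ?mulr0// eq_sym.
by rewrite linearZl_LR linearZr_LR /= mulrA normCK.
Qed.

Lemma dot_sum_suborthonormal_le e n (c : nat -> R[i]) : suborthonormal e ->
  dot (\sum_(i < n) c i *: e i) (\sum_(i < n) c i *: e i) <= \sum_(i < n) `|c i| ^+ 2.
Proof.
move=> eo; rewrite dot_sum_suborthonormal//; apply: ler_sum => i _.
by rewrite ler_piMr ?exprn_ge0// eo.2.
Qed.

(** Expand [0 <= |x - y|^2 = |x|^2 - 2 s + |y|^2]. With zero or short vectors in the family [|y|^2]
    need not equal [s], but [|y|^2 <= s] suffices. *)
Lemma bessel e n x : suborthonormal e ->
  \sum_(i < n) `|dot x (e i)| ^+ 2 <= dot x x.
Proof.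
move=> eo; set s := \sum_(i < n) _.
pose y := \sum_(i < n) dot x (e i) *: e i.
have yx : dot x y = s.
  by rewrite linear_sumr; apply: eq_bigr => i _; rewrite linearZr_LR /= mulrC normCK.
have sr : Num.conj s = s.
  by apply/CrealP/ger0_real/sumr_ge0 => i _; rewrite exprn_ge0.
have := dnorm_ge0 dot (x - y).
rewrite dnormB yx sr => xy.
have ys : dot y y <= s by exact: (dot_sum_suborthonormal_le n (fun i => dot x (e i)) eo).
rewrite -subr_ge0 (le_trans xy)// opprD addrA lerD2r.
by rewrite -addrA gerDl subr_le0.
Qed.

(** Bessel for [e] bounds the coefficients and near-orthonormality of [f] bounds the image.
    Exchanging [e] and [f] produces the adjoint. *)
Lemma exists_transfer e f n : inner_product_norm dot ->
  suborthonormal e -> suborthonormal f ->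
  exists A : endo V, (forall x, A x = \sum_(i < n) dot x (e i) *: f i) /\
    (forall x, `|A x| <= `|x|).
Proof.
move=> dotE eo fo; pose A x := \sum_(i < n) dot x (e i) *: f i.
have Al : linear A.
  move=> a x y; rewrite /A scaler_sumr -big_split; apply: eq_bigr => i _ /=.
  by rewrite linearDl linearZl_LR /= scalerDl scalerA.
have A1 x : `|A x| <= `|x|.
  rewrite -(@ler_pXn2r _ 2)// ?nnegrE// !dotE.
  exact: le_trans (dot_sum_suborthonormal_le n (fun i => dot x (e i)) fo) (bessel n x eo).
have Ac : continuous A.
  pose lA : {linear V -> V} := HB.pack A (GRing.isLinear.Build _ _ _ _ _ Al).
  apply/(@linear_bounded_continuous _ _ _ lA)/linear_boundedP.
  near=> r; move=> x /=; apply: (le_trans (A1 x)).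
  by rewrite ler_peMl//; near: r; exact: nbhs_pinfty_ge.
have AP : A \in cont_linear by apply/cont_linearP.
by exists (Endo AP).
Unshelve. all: by end_near. Qed.

(** Gram-Schmidt: infinite dimension supplies a vector outside the span of the first [n], and its
    normalised orthogonal part replaces the zero at index [n]. *)
Lemma exists_orthonormal n : ~ finite_dimensional V ->
  exists e, forall i j, dot (e i) (e j) = ((i == j) && (i < n)%N)%:R.
Proof.
move=> Vinf; elim: n => [|n [e eo]].
  by exists (cst 0) => i j; rewrite linear0l ltn0 andbF.
have [x xe] : exists x, forall c : 'I_n -> R[i], x <> \sum_(i < n) c i *: e i.
  apply: contra_notP Vinf => h; exists n, (fun i => e i) => x.
  by apply: contra_notP h => h; exists x => c xc; apply: h; exists c.
pose y := x - \sum_(i < n) dot x (e i) *: e i.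
have y0 : y != 0.
  by rewrite subr_eq0; apply/eqP; exact: (xe (fun i => dot x (e i))).
have ye j : dot y (e j) = 0.
  rewrite linearBl /= linear_sumlz; apply/eqP; rewrite subr_eq0; apply/eqP.
  have [jn|nj] := ltnP j n.
    rewrite (bigD1 (Ordinal jn))//= big1 ?addr0.
      by rewrite linearZl_LR /= eo eqxx jn mulr1.
    move=> i ij; rewrite linearZl_LR /= eo.
    by move: ij; rewrite -val_eqE /= => /negbTE ->; rewrite mulr0.
  have -> : e j = 0 by apply/eqP; rewrite -(dnorm_eq0 dot) eo eqxx ltnNge nj.
  by rewrite linear0r big1// => i _; rewrite linear0r.
pose u := (sqrtC (dot y y))^-1 *: y.
have uu : dot u u = 1.
  rewrite dnormZ normfV ger0_norm ?sqrt_dnorm_ge0// exprVn sqrtCK.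
  by rewrite mulVf// dnorm_eq0.
have ue j : dot u (e j) = 0 by rewrite linearZl_LR /= ye mulr0.
have eu j : dot (e j) u = 0 by rewrite dotC ue conjC0.
exists (fun i => if i == n then u else e i) => i j /=.
have [->|ni] := eqVneq i n; have [jn|nj] := eqVneq j n => /=.
- by rewrite uu ltnSn.
- by rewrite ue.
- by rewrite eu jn (negbTE ni).
- by rewrite eo ltnS [(i <= n)%N]leq_eqVlt (negbTE ni).
Qed.

End orthonormal.

(** * Unboundedness at [z0] through truncated shifts *)

Section shift.
Context {R : realType} {V : normedModType R[i]} (dot : {dot V for Num.conj}).

Lemma flat_metrics_unbounded (z0 : R[i]) n :
  inner_product_norm dot -> ~ finite_dimensional V -> z0 != 0 ->
  exists2 P, flat_metrics dot ((1 + `|z0|^-1) ^+ 2 *: (1 : endo V)) P &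
    n%:R <= opnorm (P z0).
Proof.
move=> dotE Vinf z0n; have [e eo] := exists_orthonormal dot n Vinf.
have so : suborthonormal dot e.
  split=> [i j /negbTE ij|i]; first by rewrite eo ij.
  by rewrite eo lern1 leq_b1.
have so' : suborthonormal dot (e \o succn).
  by split=> [i j ij|i] /=; [rewrite so.1|rewrite so.2].
have [S [SE S1]] := exists_transfer n dotE so so'.
have [S' [S'E _]] := exists_transfer n dotE so' so.
pose a : R[i] := `|z0|^-1.
have a0 : 0 < a by rewrite invr_gt0 normr_gt0.
have ar : Num.conj a = a by apply/CrealP; exact: gtr0_real.
have SS' : adjoint dot S S'.
  move=> x y; rewrite SE S'E linear_sumlz linear_sumr; apply: eq_bigr => i _ /=.
  by rewrite linearZl_LR linearZr_LR /= -dotC mulrC.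
(* Valid for every [j]: past the end of the family both sides are [0]. Powers of [S] then need no
   case distinction. *)
have Se j : S (e j) = e j.+1.
  have [jn|nj] := ltnP j n.
    rewrite SE (bigD1 (Ordinal jn))//= big1 ?addr0.
      by rewrite eo eqxx jn scale1r.
    move=> i ij; rewrite eo.
    by move: ij; rewrite -val_eqE /= eq_sym => /negbTE ->; rewrite scale0r.
  have e0 k : (n <= k)%N -> e k = 0.
    by move=> nk; apply/eqP; rewrite -(dnorm_eq0 dot) eo eqxx ltnNge nk.
  by rewrite !e0 ?linear0// ltnW.
have Ske k j : (S ^+ k) (e j) = e (k + j)%N.
  elim: k => [//|k IHk]; rewrite exprS addSn -Se -IHk.
  exact: erefl.
(* The first application of [S] lands in the span of the [e (i.+1)]; the other [n] push every index
   beyond the last nonzero vector. *)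
have S0 : S ^+ n.+1 = 0.
  apply: endoP => x; rewrite exprSr -[LHS]/((S ^+ n) (S x)) SE linear_sum big1// => i _.
  rewrite linearZ /= Ske; apply/eqP; rewrite scaler_eq0; apply/orP; right.
  by rewrite -(dnorm_eq0 dot) eo eqxx ltnNge leq_addr.
pose A := a *: S; pose B := a *: S'.
have AB : adjoint dot A B.
  move=> x y; rewrite -[A x]/(a *: S x) -[B y]/(a *: S' y).
  by rewrite linearZl_LR linearZr_LR /= ar SS'.
have A0 : A ^+ n.+1 = 0 by rewrite exprZ_endo S0 scaler0.
have c0 : 0 < 1 + a by rewrite addr_gt0.
have Ac x : `|x| + `|A x| <= (1 + a) * `|x|.
  rewrite mulrDl mul1r lerD2l -[A x]/(a *: S x) normrZ gtr0_norm//.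
  by rewrite ler_pM2l.
have PF := nilpotent_metric_flat dotE c0 AB A0 Ac.
exists (nilpotent_metric A B n.+1 (1 + a)) => //.
(* For [n = 0] the vector [e 0] is zero and cannot serve as the unit test vector. *)
have [->|n0] := posnP n; first exact: opnorm_ge0.
pose x := e 0%N; have x1 : dot x x = 1 by rewrite eo eqxx n0.
set P := nilpotent_metric _ _ _ _.
have Fx : ((1 + a) *: geometric A n.+1 z0) x =
    \sum_(k < n.+1) ((1 + a) * (z0 * a) ^+ k) *: e k.
  rewrite -[LHS]/((1 + a) *: geometric A n.+1 z0 x).
  have -> : geometric A n.+1 z0 x = \sum_(k < n.+1) (z0 * a) ^+ k *: e k.
    rewrite /geometric (big_morph (fun D : endo V => D x) (op1 := +%R) (id1 := 0))//.
    apply: eq_bigr => k _; rewrite scalerA exprZ_endo.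
    by rewrite -[LHS]/((z0 * a) ^+ k *: (S ^+ k) x) Ske addn0.
  by rewrite scaler_sumr; apply: eq_bigr => k _; rewrite scalerA.
(* This is why [a = |z0|^-1]: all coefficients of [F(z0) e_0] get the same modulus [1 + a]. *)
have za : `|z0 * a| = 1.
  by rewrite normrM [`|a|]gtr0_norm// mulfV// normr_eq0.
have Px : dot (P z0 x) x = (1 + a) ^+ 2 * n%:R.
  rewrite (nilpotent_metric_dot c0 AB A0) Fx (dot_sum_suborthonormal _
    (fun k => (1 + a) * (z0 * a) ^+ k) so).
  under eq_bigr => k _.
    rewrite normrM normrX za expr1n mulr1 gtr0_norm// eo eqxx /=; over.
  (* Of the [n.+1] terms the last one vanishes because [e n = 0], leaving [n] equal terms. *)
  rewrite -mulr_sumr big_ord_recr /= ltnn addr0; congr (_ * _).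
  under eq_bigr => k _ do rewrite ltn_ord.
  by rewrite sumr_const card_ord.
have nP : n%:R <= `|P z0 x|.
  (* Bessel for the single vector [x] replaces Cauchy-Schwarz. *)
  apply: (@le_trans _ _ `|dot (P z0 x) x|).
    rewrite Px ger0_norm; last by rewrite mulr_ge0// exprn_ge0// ltW.
    by rewrite ler_peMl// exprn_ege1// lerDl ltW.
  rewrite -(@ler_pXn2r _ 2)// ?nnegrE// dotE.
  by have := bessel 1 (P z0 x) so; rewrite big_ord1.
have := opnorm_ub (P z0) x.
have -> : `|x| = 1.
  by apply/eqP; rewrite -(@eqrXn2 _ 2)// dotE x1 expr1n.
rewrite /= mulr1; apply: le_trans.
by rewrite -lecR ReK rmorph_nat.
Qed.

End shift.

Theorem theorem5p1 (R : realType) (V : completeNormedModType R[i])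
    (dot : {dot V for Num.conj}) (z0 : R[i]) :
  inner_product_norm dot ->
  ~ finite_dimensional V ->
  unit_disc z0 -> z0 <> 0 ->
  exists T : endo V,
    [/\ End_plus dot T,
        exists c : R[i], T = c *: (1 : endo V) &
        ereal_sup [set (opnorm (P z0))%:E | P in flat_metrics dot T] = +oo%E].
Proof.
move=> dotE Vinf _ /eqP z0n.
exists ((1 + `|z0|^-1) ^+ 2 *: (1 : endo V)); split.
(* Any metric of the family has value [T] at [0], so [T] inherits positivity and invertibility from
   it. *)
- have [P [_ + _ _ <-] _] := flat_metrics_unbounded 0 dotE Vinf z0n.
  by apply; rewrite /unit_disc /= normr0.
- by exists ((1 + `|z0|^-1) ^+ 2).
(* [T] does not depend on the length of the shift, so that length can be chosen to exceed [M]. *)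
- apply/eqyP => M M0; have [P PF nP] := flat_metrics_unbounded (Num.truncn M).+1 dotE Vinf z0n.
  apply: (@le_trans _ _ (opnorm (P z0))%:E); last by apply: ereal_sup_ubound; exists P.
  by rewrite lee_fin (le_trans _ nP)// ltW// truncnS_gt.
Qed.
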